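(* For each positive integer $n$, let $f(n)$ denote the minimum number of cops needed to win Covering (against a robber of speed $2$) on the grid $[n]^2$. Then $f(n)=O(n^{1.999})$; that is, there exist a constant $C>0$ and an integer $n_0$ such that $f(n)\le C\,n^{1.999}$ for all $n\ge n_0$.
   Context: The grid $[n]^2$ is the graph with vertex set $\{1,\dots,n\}^2$ in which two distinct vertices are adjacent if and only if each coordinate differs by at most $1$ (so graph distance is the $l_\infty$ distance). The game of Covering on a graph $G$ is a perfect information game played by a team of cops and one robber, each occupying vertices of $G$ (several cops may occupy the same vertex). The cops choose the starting configuration, meaning the initial vertices of all the cops and of the robber. The two sides then take turns alternately forever, the cops going first. On the cops' turn, each cop moves to an adjacent vertex or stays put. On the robber's turn, he moves to any vertex at graph distance at most $2$ from his current vertex (possibly staying put). The cops win if after every one of their turns at least one cop occupies the same vertex as the robber. A number $m$ of cops ''can win'' if $m$ cops have a strategy guaranteeing this against every play of the robber; the number of cops needed to win Covering on $G$ is the minimum such $m$. *)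

(* Defs.v *)
From HB Require Import structures.
From mathcomp Require Import all_boot all_order all_algebra.
From mathcomp Require Import all_classical all_reals all_analysis.

Set Implicit Arguments.
Unset Strict Implicit.
Unset Printing Implicit Defensive.

Import Order.TTheory GRing.Theory Num.Theory.

Local Open Scope ring_scope.

Section Covering.
Variables (T : finType) (e : rel T).

Definition dist_le (k : nat) (x y : T) : Prop :=
  exists p : seq T, [/\ path e x p, last x p = y & (size p <= k)%N].

Section Game.
Variable m : nat.

Definition cops := {ffun 'I_m -> T}.

Definition position := (cops * T)%type.

Definition cops_move (c c' : cops) : Prop :=
  forall i, c' i = c i \/ e (c i) (c' i).

Definition robber_move (r r' : T) : Prop := dist_le 2 r r'.

(* The history given to a strategy is the sequence of all the positions in
   which the cops were to move, the current one being the last. *)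
Definition strategy := seq position -> cops.

(* [play t] is the position just before the (t+1)-st turn of the cops; that
   turn takes the cops to [(play t.+1).1] while the robber is at [(play t).2],
   and the robber then moves to [(play t.+1).2]. *)
Definition play_against (p0 : position) (s : strategy) (play : nat -> position)
    : Prop :=
  [/\ play 0 = p0,
      forall t, (play t.+1).1 = s (mkseq play t.+1)
    & forall t, robber_move (play t).2 (play t.+1).2].

Definition covered (c : cops) (r : T) : Prop := exists i, c i = r.

Definition winning (p0 : position) (s : strategy) : Prop :=
  forall play, play_against p0 s play ->
  forall t, cops_move (play t).1 (play t.+1).1
            /\ covered (play t.+1).1 (play t).2.

Definition can_win : Prop := exists p0 s, winning p0 s.

End Game.

Lemma can_win_card : (0 < #|T|)%N -> can_win #|T|.
Proof.
move=> /card_gt0P[x0 _].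
pose c : cops #|T| := [ffun i => enum_val i].
exists (c, x0), (fun=> c) => play [p0E csE _] t; split; last first.
  by exists (enum_rank (play t).2); rewrite csE ffunE enum_rankK.
by move=> i; left; rewrite csE; case: t => [|t]; rewrite ?p0E ?csE.
Qed.

Lemma ex_can_win : (0 < #|T|)%N -> exists m, `[< can_win m >].
Proof. by move=> T_gt0; exists #|T|; apply/asboolP; exact: can_win_card. Qed.

(* The value 0 for a graph without vertices, which has no starting
   configuration, is a dummy. *)
Definition covering_number : nat :=
  if pselect (0 < #|T|)%N is left T_gt0 then ex_minn (ex_can_win T_gt0) else 0.

Lemma covering_numberP : (0 < #|T|)%N ->
  can_win covering_number /\
  forall m, can_win m -> (covering_number <= m)%N.
Proof.
rewrite /covering_number; case: pselect => // T_gt0 _.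
case: ex_minnP => m /asboolP win_m min_m; split=> // k /asboolP.
exact: min_m.
Qed.

End Covering.

(* Vertices are numbered from 0 rather than from 1. *)
Definition grid (n : nat) : rel ('I_n * 'I_n) :=
  fun x y => [&& x != y, `|x.1 - y.1| <= 1 & `|x.2 - y.2| <= 1]%N.

(* Main.v *)
Require Import Defs.
From HB Require Import structures.
From mathcomp Require Import all_boot all_order all_algebra.
From mathcomp Require Import all_classical all_reals all_analysis.
From mathcomp Require Import zify lra.

(** The bound comes from the recursion f(K n) <= (K^2 - 1) f(n), valid for every
K >= 12 ([can_win_blocks]): cut the board into K^2 blocks of side n, let a team
of f(n) cops guard each block, and save one team.  Iterating from f(1) = 1 with
K = 12 gives f(12^l) <= 143^l; as f is monotone ([can_win_shrink]) and
143 <= 12^1.999 ([step_exponent]), this is at most 143 n^1.999 for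
12^(l-1) <= n < 12^l.

A team guards its block by playing the game on the block against a shadow of the
robber.  The shadow is a 1-Lipschitz function of the robber's position, so it
moves legally; it coincides with the robber inside the block, and it is a fixed
corner of the block as soon as the robber is at distance at least 2n from that
corner ([shadow_lipschitz], [shadow_in], [shadow_far]).  While the shadow rests
in that corner the game of the team can be suspended, and the team may spend its
turns on moving rigidly with its block, at speed 1.  So it suffices to move
blocks around such that the robber is always inside one of them and no block
moves when he is near it ([relay]).

With K^2 - 1 blocks, keep all places of the K by K tiling filled except one
corner of the board, the hole, as long as the robber is at distance at least 4n
from it.  When he is about to come closer, one of his two coordinates still differs from
that of the hole by at least 4n; in that coordinate he is then equally far from
the whole side of the board that starts at the hole and runs in the other
direction.  All blocks of this side move by n towards the hole, which takes n
turns and transfers the hole to the other end of the side.  Meanwhile the robber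
moves by at most 2n, so he stays at distance at least 2n from the moving blocks,
and since the side is at least 11n long he ends up at distance at least 4n from
the new hole ([shift_step], [shift_done], [idle_step]). *)

Set Implicit Arguments.
Unset Strict Implicit.
Unset Printing Implicit Defensive.

Import Order.TTheory GRing.Theory Num.Theory.

(** * Winning means keeping an invariant *)

Section Positional.
Variables (T : finType) (e : rel T).

(** Indexing the cops by any finite type lets a product of types stand for a
family of teams. *)
Definition cop_invariant (I : finType) (W : {ffun I -> T} -> T -> Prop) : Prop :=
  (exists c r, W c r) /\
  forall c r, W c r -> exists c' : {ffun I -> T},
    [/\ forall i, c' i = c i \/ e (c i) (c' i), exists i, c' i = r
      & forall r', dist_le e 2 r r' -> W c' r'].

Lemma dist_le_refl k (x : T) : dist_le e k x x.
Proof. by exists [::]. Qed.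

Section Trajectory.
Variables (m : nat) (p0 : position T m) (s : strategy T m).

Fixpoint history (rho : nat -> T) (t : nat) : seq (position T m) :=
  if t is u.+1 then
    rcons (history rho u) (s (history rho u), rho u.+1)
  else [:: p0].

Definition play_along rho t := last p0 (history rho t).

Lemma mkseq_play_along rho t :
  mkseq (play_along rho) t.+1 = history rho t.
Proof.
by elim: t => [//|t IH]; rewrite mkseqS IH {1}/play_along /= last_rcons.
Qed.

Lemma eq_history rho rho' t :
  (forall u, (u <= t)%N -> rho u = rho' u) -> history rho t = history rho' t.
Proof.
elim: t => [//|t IH] E /=; rewrite IH ?E // => u ut.
by apply: E; exact: leqW.
Qed.

Lemma play_along_robber rho t : rho 0%N = p0.2 -> (play_along rho t).2 = rho t.
Proof. by case: t => [->//|t _]; rewrite /play_along /= last_rcons. Qed.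

Lemma play_alongP rho : rho 0%N = p0.2 ->
  (forall t, robber_move e (rho t) (rho t.+1)) ->
  play_against e p0 s (play_along rho).
Proof.
move=> rho0 mv; split=> // t; last by rewrite !play_along_robber.
by rewrite mkseq_play_along {1}/play_along /= last_rcons.
Qed.

End Trajectory.

(** The positions reachable under the winning strategy form the invariant: the
same position may be reached with different histories, and the reply to any one
of them will do, because the positions that follow are reachable again. *)
Lemma can_win_invariant m :
  can_win e m -> exists W : {ffun 'I_m -> T} -> T -> Prop, cop_invariant W.
Proof.
move=> [p0 [s win]].
pose legal (rho : nat -> T) :=
  rho 0%N = p0.2 /\ forall t, robber_move e (rho t) (rho t.+1).
exists (fun c r => exists rho t, legal rho /\ play_along p0 s rho t = (c, r)).
split.
  exists p0.1, p0.2, (fun=> p0.2), 0%N.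
  by split; [split=> // t; exact: dist_le_refl | case: p0 {win legal}].
move=> c r [rho [t [[rho0 mv] E]]].
have [mvt cov] := win _ (play_alongP s rho0 mv) t.
rewrite E /= in mvt cov.
exists (play_along p0 s rho t.+1).1; split=> // r' rr'.
have rhot : rho t = r by rewrite -(play_along_robber s t rho0) E.
(* The robber follows rho up to time t, jumps to r' and stays there. *)
exists (fun u => if (u <= t)%N then rho u else r'), t.+1; split.
  split=> // u; case: (ltngtP u t) => [ut|ut|->].
  - exact: mv.
  - exact: dist_le_refl.
  - by rewrite rhot.
rewrite /play_along /= !last_rcons /= ltnn.
by rewrite (@eq_history _ _ _ _ rho) // => u ->.
Qed.

Lemma invariant_can_win (I : finType) (W : {ffun I -> T} -> T -> Prop) m :
  #|I| = m -> cop_invariant W -> can_win e m.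
Proof.
move=> <- [[c0 [r0 W0]] step].
have /choice[next nextP] : forall p : {ffun I -> T} * T,
    exists c' : {ffun I -> T}, W p.1 p.2 ->
    [/\ forall i, c' i = p.1 i \/ e (p.1 i) (c' i), exists i, c' i = p.2
      & forall r', dist_le e 2 p.2 r' -> W c' r'].
  move=> p; have [/step[c' c'P]|nW] := pselect (W p.1 p.2); first by exists c'.
  by exists p.1.
pose num (c : {ffun I -> T}) : cops T #|I| := [ffun k => c (enum_val k)].
pose den (c : cops T #|I|) : {ffun I -> T} := [ffun i => c (enum_rank i)].
have numK : cancel num den by move=> c; apply/ffunP=> i; rewrite !ffunE enum_rankK.
pose p0 : position T #|I| := (num c0, r0).
exists p0, (fun h => num (next (den (last p0 h).1, (last p0 h).2))).
move=> play [play0 cE mv].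
have lastE t : last p0 (mkseq play t.+1) = play t.
  by rewrite mkseqS last_rcons.
have nextE t : (play t.+1).1 = num (next (den (play t).1, (play t).2)).
  by rewrite cE lastE.
have inW t : W (den (play t).1) (play t).2.
  elim: t => [|t IH]; first by rewrite play0 numK.
  by rewrite nextE numK; have [_ _] := nextP (_, _) IH; apply; exact: mv.
move=> t; have [mvc [i ri] _] := nextP (_, _) (inW t); rewrite nextE; split.
  by move=> k; have := mvc (enum_val k); rewrite !ffunE enum_valK.
by exists (enum_rank i); rewrite ffunE enum_rankK.
Qed.

End Positional.

(** * Geometry of the grid *)

(** Indexing the two coordinates by [bool] makes [~~ a] the axis perpendicular to
[a], so that one argument serves both directions. *)
Definition crd n (x : 'I_n * 'I_n) (b : bool) : nat := if b then x.1 else x.2.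

(** The distance bound is on integer points that need not be vertices of a grid:
it is also used for the corners of moving blocks. *)
Definition linf_le (k : nat) (x y : bool -> nat) : Prop :=
  forall b, (x b <= y b + k)%N && (y b <= x b + k)%N.

Lemma crd_lt n (x : 'I_n * 'I_n) b : (crd x b < n)%N.
Proof. by rewrite /crd; case: b. Qed.

Lemma crd_inj n (x y : 'I_n * 'I_n) : crd x =1 crd y -> x = y.
Proof.
move: x y => [x1 x2] [y1 y2] E.
by congr pair; apply/val_inj; [exact: (E true) | exact: (E false)].
Qed.

Lemma crd_ex n (f : bool -> nat) : (forall b, f b < n)%N ->
  exists x : 'I_n * 'I_n, crd x =1 f.
Proof. by move=> fn; exists (Ordinal (fn true), Ordinal (fn false)); case. Qed.

Lemma linf_le_refl k x : linf_le k x x.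
Proof. by move=> b; rewrite leq_addr. Qed.

Lemma grid_stepP n (x y : 'I_n * 'I_n) :
  y = x \/ grid x y <-> linf_le 1 (crd x) (crd y).
Proof.
split=> [[->|/and3P[_ h1 h2]]|h]; first exact: linf_le_refl.
  by case; rewrite /crd; lia.
have [->|yx] := eqVneq y x; [by left | right].
rewrite /grid eq_sym yx /=.
by move: (h true) (h false); rewrite /crd; lia.
Qed.

(** Each coordinate first goes as far as [k] allows towards its goal; the point
obtained lies in the box spanned by [x] and [y], hence in the grid. *)
Lemma linf_split n k l (x y : 'I_n * 'I_n) : linf_le (k + l) (crd x) (crd y) ->
  exists z : 'I_n * 'I_n, linf_le k (crd x) (crd z) /\ linf_le l (crd z) (crd y).
Proof.
move=> h.
pose f b := maxn (crd x b - k) (minn (crd y b) (crd x b + k)).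
have [z zf] : exists z : 'I_n * 'I_n, crd z =1 f.
  apply: crd_ex => b; move: (crd_lt x b) (crd_lt y b); rewrite /f; lia.
by exists z; split=> b; move: (h b); rewrite zf /f; lia.
Qed.

Lemma grid_dist2P n (x y : 'I_n * 'I_n) :
  dist_le (@grid n) 2 x y <-> linf_le 2 (crd x) (crd y).
Proof.
split=> [[p [pth <- sz]]|].
  case: p pth sz => [|u [|v [|//]]] /=; first by move=> _ _; exact: linf_le_refl.
    rewrite andbT => xu _ b; have /grid_stepP/(_ b) := or_intror (u = x) xu; lia.
  move=> /and3P[xu uv _] _ b.
  have /grid_stepP/(_ b) := or_intror (u = x) xu.
  have /grid_stepP/(_ b) := or_intror (v = u) uv; lia.
move=> /(@linf_split n 1 1)[z [/grid_stepP xz /grid_stepP zy]].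
case: xz zy => [->|xz] zy.
  by case: zy => [->|zy]; [exists [::] | exists [:: y]; rewrite /= zy].
case: zy => [->|zy]; first by exists [:: z]; rewrite /= xz.
by exists [:: z; y]; rewrite /= xz zy.
Qed.

Lemma grid_invariantP n (I : finType)
    (W : {ffun I -> 'I_n * 'I_n} -> 'I_n * 'I_n -> Prop) :
  cop_invariant (@grid n) W <->
  (exists c r, W c r) /\
  forall c r, W c r -> exists c' : {ffun I -> 'I_n * 'I_n},
    [/\ forall i, linf_le 1 (crd (c i)) (crd (c' i)), exists i, c' i = r
      & forall r', linf_le 2 (crd r) (crd r') -> W c' r'].
Proof.
split=> -[ne step]; split=> // c r /step[c' [mv cov next]];
  exists c'; split=> //.
- by move=> i; apply/grid_stepP.
- by move=> r' /grid_dist2P; exact: next.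
- by move=> i; apply/grid_stepP.
- by move=> r' /grid_dist2P; exact: next.
Qed.

(** The robber may walk anywhere, and the cops keep the invariant meanwhile; so an
invariant gives a starting configuration for every position of the robber. *)
Lemma invariant_reach n (I : finType)
    (W : {ffun I -> 'I_n * 'I_n} -> 'I_n * 'I_n -> Prop) :
  cop_invariant (@grid n) W -> forall y, exists c, W c y.
Proof.
move=> /grid_invariantP[[c0 [r0 W0]] step] y.
suff H k : forall z, linf_le k (crd r0) (crd z) -> exists c, W c z.
  apply: (H n) => b; move: (crd_lt r0 b) (crd_lt y b); lia.
elim: k => [|k IH] z.
  by move=> h; exists c0; rewrite -(@crd_inj _ r0 z) // => b; move: (h b); lia.
rewrite -addn1 => /linf_split[u [/IH[c /step[c' [_ _ next]]] uz]].
by exists c'; apply: next => b; move: (uz b); lia.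
Qed.

(** Clamping the coordinates retracts the large grid onto the small one without
increasing distances: the cops follow the images of cops that play on the large
grid, where the robber happens to stay in the small one. *)
Lemma can_win_shrink n n' m : (0 < n <= n')%N ->
  can_win (@grid n') m -> can_win (@grid n) m.
Proof.
move=> /andP[n0 nn'] /can_win_invariant[W invW].
have widen (x : 'I_n * 'I_n) : exists x' : 'I_n' * 'I_n', crd x' =1 crd x.
  by apply: crd_ex => b; exact: leq_trans (crd_lt x b) nn'.
have clamp (x' : 'I_n' * 'I_n') :
    exists x : 'I_n * 'I_n, forall b, crd x b = minn (crd x' b) n.-1.
  by apply: crd_ex => b /=; lia.
apply: (@invariant_can_win _ _ _ (fun c r => exists c' r',
  [/\ W c' r', crd r' =1 crd r
    & forall i b, crd (c i) b = minn (crd (c' i) b) n.-1]) _ (card_ord m)).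
have retract (c' : {ffun 'I_m -> 'I_n' * 'I_n'}) :
    exists c : {ffun 'I_m -> 'I_n * 'I_n},
      forall i b, crd (c i) b = minn (crd (c' i) b) n.-1.
  have /fin_all_exists[f fP] := fun i => clamp (c' i).
  by exists [ffun i => f i] => i b; rewrite ffunE.
apply/grid_invariantP; split.
  have [x _] : exists x : 'I_n * 'I_n, crd x =1 (fun=> 0%N) by exact: crd_ex.
  have [x' x'x] := widen x; have [c' W'] := invariant_reach invW x'.
  by have [c cc'] := retract c'; exists c, x, c', x'.
have [_ step] := (grid_invariantP W).1 invW.
move=> c r [c' [r' [/step[d' [mv [i cov] next]] r'r cc']]].
have [d dd'] := retract d'; exists d; split.
- move=> j b; move: (mv j b); rewrite cc' dd'.
  by move: (crd _ b) (crd _ b) => u v; lia.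
- exists i; apply: crd_inj => b; rewrite dd' cov r'r.
  by move: (crd_lt r b); lia.
move=> x rx; have [x' x'x] := widen x; exists d', x'; split=> //.
by apply: next => b; rewrite r'r x'x.
Qed.

(** * Guarding a moving block *)

Definition gap (x y : nat) : nat := ((x - y) + (y - x))%N.

Definition far (n : nat) (p x : bool -> nat) : Prop :=
  exists b, (2 * n <= gap (x b) (p b))%N.

(** Position of the shadow relative to the corner [p] of the block.  Each of the
three terms is 1-Lipschitz in [x], hence so is their minimum; the second keeps
the shadow in the block, and the third, which exceeds [n] for [x] in the block,
forces the shadow into the corner when [x] is far from [p]. *)
Definition shadow (n : nat) (p x : bool -> nat) (b : bool) : nat :=
  minn (minn (x b - p b) n.-1)
       (2 * n - maxn (gap (x true) (p true)) (gap (x false) (p false))).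

Lemma shadow_lt n p x b : (0 < n)%N -> (shadow n p x b < n)%N.
Proof. rewrite /shadow; lia. Qed.

Lemma shadow_lipschitz n k p x y :
  linf_le k x y -> linf_le k (shadow n p x) (shadow n p y).
Proof.
suff le u v : linf_le k u v -> forall b, (shadow n p u b <= shadow n p v b + k)%N.
  by move=> xy b; rewrite !le // => a; rewrite andbC xy.
move=> uv b; have gapS a : (gap (v a) (p a) <= gap (u a) (p a) + k)%N.
  by move: (uv a); rewrite /gap; lia.
move: (gapS true) (gapS false) (uv b); rewrite /shadow.
move: (gap _ _) (gap _ _) (gap _ _) (gap _ _) => g1 g2 g3 g4; lia.
Qed.

Lemma shadow_far n p x b : far n p x -> shadow n p x b = 0%N.
Proof. by case=> -[]; rewrite /shadow; lia. Qed.

Lemma shadow_in n p x b : (forall a, p a <= x a < p a + n)%N ->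
  shadow n p x b = (x b - p b)%N.
Proof.
move=> h; have gap_lt a : (gap (x a) (p a) < n)%N.
  by move: (h a); rewrite /gap; lia.
move: (gap_lt true) (gap_lt false) (h b); rewrite /shadow.
move: (gap _ _) (gap _ _) => g1 g2; lia.
Qed.

(** Here [p] gives the corners of the blocks guarded by the teams [I], and [Inv] is
what a higher level strategy maintains about them and the robber.  A team whose
block stays put answers the move of its shadow; one whose block moves keeps its
formation, and this is sound because the shadow sits at the corner of the block
both before and after, so that the suspended game is still in the same
position. *)
Lemma relay n N (I J : finType)
    (W : {ffun J -> 'I_n * 'I_n} -> 'I_n * 'I_n -> Prop)
    (Inv : (I -> bool -> nat) -> (bool -> nat) -> Prop) :
  (0 < n)%N -> cop_invariant (@grid n) W ->
  (exists p (r : 'I_N * 'I_N), Inv p (crd r)) ->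
  (forall p r, Inv p r -> forall i b, p i b + n <= N)%N ->
  (forall p (r : 'I_N * 'I_N), Inv p (crd r) -> exists p',
    [/\ exists i, forall b, (p' i b <= crd r b < p' i b + n)%N,
        forall i, p' i =1 p i \/
          [/\ linf_le 1 (p i) (p' i), far n (p i) (crd r)
            & forall r', linf_le 2 (crd r) r' -> far n (p' i) r']
      & forall r', linf_le 2 (crd r) r' -> Inv p' r']) ->
  can_win (@grid N) (#|I| * #|J|).
Proof.
move=> n0 invW [p0 [r0 Inv0]] InvN macro.
have shadow_ex p x : exists y : 'I_n * 'I_n, crd y =1 shadow n p x.
  by apply: crd_ex => b; exact: shadow_lt.
have place (p : I -> bool -> nat) (w : I -> {ffun J -> 'I_n * 'I_n}) :
    (forall i b, p i b + n <= N)%N ->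
    exists c : {ffun I * J -> 'I_N * 'I_N},
      forall i j b, crd (c (i, j)) b = (p i b + crd (w i j) b)%N.
  move=> pN.
  have /fin_all_exists[f fP] : forall ij : I * J, exists x : 'I_N * 'I_N,
      forall b, crd x b = (p ij.1 b + crd (w ij.1 ij.2) b)%N.
    move=> [i j] /=; apply: crd_ex => b /=.
    by move: (pN i b) (crd_lt (w i j) b); lia.
  by exists [ffun ij => f ij] => i j b; rewrite ffunE fP.
apply: (@invariant_can_win _ _ (I * J)%type (fun c r =>
  exists p, Inv p (crd r) /\ forall i, exists w y,
  [/\ W w y, crd y =1 shadow n (p i) (crd r)
    & forall j b, crd (c (i, j)) b = (p i b + crd (w j) b)%N])).
  exact: card_prod.
apply/grid_invariantP; split.
  have /fin_all_exists[w wP] : forall i, exists w : {ffun J -> 'I_n * 'I_n},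
      exists y, W w y /\ crd y =1 shadow n (p0 i) (crd r0).
    move=> i; have [y yE] := shadow_ex (p0 i) (crd r0).
    by have [w Ww] := invariant_reach invW y; exists w, y.
  have [c cE] := place p0 w (InvN _ _ Inv0).
  exists c, r0, p0; split=> // i; have [y [Wy yE]] := wP i.
  by exists (w i), y.
have [_ step] := (grid_invariantP W).1 invW.
move=> c r [p [Invp teams]].
have [p' [[i0 cov] moves next]] := macro p r Invp.
have InvN' := InvN _ _ (next _ (linf_le_refl 2 (crd r))).
(* [w'] is the new formation of the team, relative to its block. *)
have /fin_all_exists[w' w'P] : forall i, exists w' : {ffun J -> 'I_n * 'I_n},
    [/\ forall j b, (crd (c (i, j)) b <= p' i b + crd (w' j) b + 1)%N &&
                    (p' i b + crd (w' j) b <= crd (c (i, j)) b + 1)%N,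
        forall r', linf_le 2 (crd r) r' ->
          exists y', W w' y' /\ crd y' =1 shadow n (p' i) r'
      & (forall b, p' i b <= crd r b < p' i b + n)%N ->
          exists j, forall b, crd r b = (p' i b + crd (w' j) b)%N].
  move=> i; have [w [y [Wy yE cE]]] := teams i.
  case: (moves i) => [p'E|[pp' farp farp']].
  - have [w' [mv [j covj] nextw]] := step _ _ Wy.
    exists w'; split.
    + by move=> k b; move: (mv k b); rewrite cE p'E; lia.
    + move=> r' rr'; have [y' y'E] := shadow_ex (p' i) r'; exists y'.
      split=> //; apply: nextw => b; rewrite yE y'E (funext p'E).
      exact: shadow_lipschitz.
    + move=> inb; exists j => b; rewrite covj yE -(funext p'E) shadow_in //.
      by move: (inb b); lia.
  - exists w; split.
    + by move=> k b; move: (pp' b); rewrite cE; lia.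
    + move=> r' rr'; exists y; split=> // b.
      by rewrite yE !shadow_far //; exact: farp'.
    + move=> inb; have [b] := farp' _ (linf_le_refl 2 (crd r)).
      by move: (inb b); rewrite /gap; lia.
have [c' c'E] := place p' w' InvN'.
exists c'; split.
- by move=> [i j] b; have [/(_ j b) + _ _] := w'P i; rewrite c'E.
- have [_ _ /(_ cov)[j jE]] := w'P i0; exists (i0, j).
  by apply: crd_inj => b; rewrite c'E jE.
move=> r' rr'; exists p'; split; first exact: next.
move=> i; have [_ /(_ _ rr')[y' [Wy' y'E]] _] := w'P i.
by exists (w' i), y'.
Qed.

(** * Moving the hole of a tiling *)

Section Tiling.
Variables (I : Type) (K n : nat).
Hypotheses (K_ge12 : (12 <= K)%N) (n_gt0 : (0 < n)%N).
Implicit Types (p : I -> bool -> nat) (r q : bool -> nat) (a : bool).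

(** [q] is the hole, a corner of the K by K array of places. *)
Definition tiles (cell : I -> bool -> nat) q : Prop :=
  [/\ forall i b, (cell i b < K)%N, forall b, q b = 0%N \/ q b = K.-1
    & forall c : bool -> nat, (forall b, c b < K)%N -> (exists b, c b <> q b) ->
        exists i, cell i =1 c].

Definition slide k (q c : nat) : nat :=
  (if c < q then n * c + k else if q < c then n * c - k else n * c)%N.

Definition on_side a (cell : I -> bool -> nat) q i : bool :=
  cell i (~~ a) == q (~~ a).

(** The configuration after [k] turns of the transfer along the side of the board
through the hole parallel to axis [a]. *)
Definition slid a k (cell : I -> bool -> nat) q i b : nat :=
  if (b == a) && on_side a cell q i then slide k (q b) (cell i b)
  else (n * cell i b)%N.

Definition idle p r : Prop := exists cell q,
  [/\ tiles cell q, forall i b, p i b = (n * cell i b)%N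
    & exists b, (4 * n <= gap (r b) (n * q b))%N].

(** The two distance bounds are those that hold when the transfer starts, weakened
by the distance [2 * k] that the robber may have covered since.  The upper bound
keeps him away from the other end of the side. *)
Definition shifting p r : Prop := exists cell q a k,
  [/\ tiles cell q, forall i b, p i b = slid a k cell q i b, (k <= n)%N,
      (4 * n <= gap (r (~~ a)) (n * q (~~ a)) + 2 * k)%N
    & (gap (r a) (n * q a) <= 4 * n + 1 + 2 * k)%N].

Lemma gap_linf k x y c : linf_le k x y ->
  forall b, (gap (y b) c <= gap (x b) c + k)%N &&
            (gap (x b) c <= gap (y b) c + k)%N.
Proof. by move=> xy b; move: (xy b); rewrite /gap; lia. Qed.

Lemma in_own_block (x : nat) : (n * (x %/ n) <= x < n * (x %/ n) + n)%N.
Proof. by rewrite mulnC leq_divM -mulSnr ltn_ceil. Qed.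

(** A robber at distance at least [n] from the corner of the hole is not in the
hole. *)
Lemma robber_tile cell q r : tiles cell q -> (forall b, r b < K * n)%N ->
  (exists b, n <= gap (r b) (n * q b))%N ->
  exists i, cell i =1 (fun b => r b %/ n) /\
    forall b, (n * cell i b <= r b < n * cell i b + n)%N.
Proof.
move=> [_ _ onto] rK [b far_b].
have [i iE] : exists i, cell i =1 (fun b => r b %/ n).
  apply: onto => [a|]; first by rewrite ltn_divLR.
  exists b => rq; move: (in_own_block (r b)) far_b; rewrite rq /gap; lia.
by exists i; split=> // a; rewrite iE in_own_block.
Qed.

(** Once every block of the side has moved by [n], the configuration is again a
tiling, with the hole at the opposite end of the side.  The robber is within
6n + 1 of the old hole along the side, whose length is at least 11n, hence at
distance at least 5n - 1 >= 4n from the new one. *)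
Lemma shift_done p r cell q a : tiles cell q ->
  (forall i b, p i b = slid a n cell q i b) ->
  (gap (r a) (n * q a) <= 6 * n + 1)%N -> idle p r.
Proof.
move=> [cellK qE onto] pE near_a.
pose cell' i b := if (b == a) && on_side a cell q i then
  (if cell i b < q b then (cell i b).+1
   else if q b < cell i b then (cell i b).-1 else cell i b)%N else cell i b.
pose q' b := if b == a then (K.-1 - q b)%N else q b.
have na : ~~ a == a = false by case: a {pE near_a cell' q'}.
exists cell', q'; split.
- split=> [i b|b|c cK [b cq]].
  + move: (cellK i b) (qE b); rewrite /cell'; do !case: ifP; lia.
  + by move: (qE b); rewrite /q'; case: ifP; lia.
    (* [c'] is the place from which the block now in place [c] has come. *)
  + pose c' d := if (d == a) && (c (~~ a) == q (~~ a)) then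
      (if q d == 0 then (c d).+1 else (c d).-1)%N else c d.
    have c_a : c (~~ a) = q (~~ a) -> c a <> (K.-1 - q a)%N.
      move=> cqa cqa'; case: cq; rewrite /q'; case: eqP => [->//|].
      by move: cqa; case: (a) (b) => -[].
    have [i iE] : exists i, cell i =1 c'.
      apply: onto => [d|].
        rewrite /c'; case: ifP => [/andP[/eqP-> /eqP/c_a]|_]; last exact: cK.
        by move: (cK a) (qE a); case: ifP; lia.
      have [cqa|cqa] := eqVneq (c (~~ a)) (q (~~ a)).
        exists a; rewrite /c' eqxx cqa eqxx /=.
        by move: (c_a cqa) (cK a) (qE a); case: ifP; lia.
      by exists (~~ a); rewrite /c' na; exact/eqP.
    exists i => d; rewrite /cell' /on_side !iE /c' na /=.
    case rc: ((d == a) && _) => //; move/andP: rc => [/eqP-> /eqP cqa].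
    by move: (c_a cqa) (cK a) (qE a); do !case: ifP; lia.
- move=> i b; rewrite pE /slid /cell' /slide; case: ifP => // _.
  case: ifP => [_|_]; first by rewrite mulnS addnC.
  by case: ifP => // _; rewrite -subn1 mulnBr muln1.
- exists a; rewrite /q' eqxx.
  have Kn : (11 * n <= n * K.-1)%N by rewrite mulnC leq_mul2l; lia.
  by move: near_a Kn; case: (qE a) => ->; rewrite ?subn0 ?subnn muln0 /gap; lia.
Qed.

Lemma slide_near k c c' :
  (slide k c c' <= slide k.+1 c c' + 1)%N &&
  (slide k.+1 c c' <= slide k c c' + 1)%N.
Proof. by rewrite /slide; do !case: ifP => _; lia. Qed.

(** What [relay] asks of one turn. *)
Definition stepping p r := exists p' : I -> bool -> nat,
  [/\ exists i, forall b, (p' i b <= r b < p' i b + n)%N,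
      forall i, p' i =1 p i \/
        [/\ linf_le 1 (p i) (p' i), far n (p i) r
          & forall r', linf_le 2 r r' -> far n (p' i) r']
    & forall r', linf_le 2 r r' -> idle p' r' \/ shifting p' r'].

(** All moving blocks have the coordinate of the hole on the axis [~~ a], and on
that axis the robber is at distance at least 4n - 2k, which exceeds 2n.  So he is
not on the moving side, and the block that contains him is at rest. *)
Lemma shift_step p r cell q a k : (forall b, r b < K * n)%N ->
  tiles cell q -> (forall i b, p i b = slid a k cell q i b) -> (k < n)%N ->
  (4 * n <= gap (r (~~ a)) (n * q (~~ a)) + 2 * k)%N ->
  (gap (r a) (n * q a) <= 4 * n + 1 + 2 * k)%N -> stepping p r.
Proof.
move=> rK tl pE kn far_r near_r.
have na : ~~ a == a = false by case: a {pE far_r near_r}.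
exists (slid a k.+1 cell q); split.
- have [|i [iE iin]] := robber_tile tl rK; first by exists (~~ a); lia.
  exists i => b; rewrite /slid /on_side.
  case: ifP => [/andP[_ /eqP rq]|_]; last exact: iin.
  by move: (iin (~~ a)) far_r; rewrite rq /gap; lia.
- move=> i; case sidei: (on_side a cell q i); last first.
    by left=> b; rewrite pE /slid sidei !andbF.
  have pna j : slid a j cell q i (~~ a) = (n * q (~~ a))%N.
    by rewrite /slid na; congr (_ * _)%N; exact/eqP.
  right; split.
  + move=> b; rewrite pE /slid sidei andbT.
    by case: ifP => _; [exact: slide_near | rewrite leq_addr].
  + by exists (~~ a); rewrite pE pna; lia.
  + move=> r' /(gap_linf (n * q (~~ a)))/(_ (~~ a)) rr'.
    by exists (~~ a); rewrite pna; lia.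
- move=> r' rr'; right; exists cell, q, a, k.+1; split=> //.
  + by move: (gap_linf (n * q (~~ a)) rr' (~~ a)); lia.
  + by move: (gap_linf (n * q a) rr' a); lia.
Qed.

(** At distance at least 4n + 2 from the hole the robber cannot come closer than
4n in one move, so nothing needs to be done.  Otherwise his distance is 4n or
4n + 1 and a transfer starts, perpendicular to an axis [b] that realizes it. *)
Lemma idle_step p r : (forall b, r b < K * n)%N -> idle p r -> stepping p r.
Proof.
move=> rK [cell [q [tl pE [b far_b]]]].
have [[a far_a]|close] :=
  pselect (exists a, (4 * n + 2 <= gap (r a) (n * q a))%N).
  exists p; split.
  - have [|i [_ iin]] := robber_tile tl rK; first by exists a; lia.
    by exists i => d; rewrite pE.
  - by left.
  - move=> r' rr'; left; exists cell, q; split=> //; exists a.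
    by move: (gap_linf (n * q a) rr' a); lia.
apply: (@shift_step _ _ cell q (~~ b) 0%N) => //.
- move=> i d; rewrite pE /slid /slide addn0 subn0.
  by do !case: ifP.
- by rewrite negbK; lia.
- by rewrite leqNgt; apply/negP => ?; apply: close; exists (~~ b); lia.
Qed.

Lemma tiling_step p r : (forall b, r b < K * n)%N ->
  idle p r \/ shifting p r -> stepping p r.
Proof.
move=> rK [|[cell [q [a [k [tl pE kn far_r near_r]]]]]]; first exact: idle_step.
have [kn'|nk] := ltnP k n; first exact: (shift_step rK tl pE).
have En : k = n by lia.
apply: idle_step => //; apply: (shift_done (a := a) tl) => [i b|]; last by lia.
by rewrite pE En.
Qed.

Lemma tiling_bound p r : idle p r \/ shifting p r ->
  forall i b, (p i b + n <= K * n)%N.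
Proof.
have in_board c : (c < K)%N -> (n * c + n <= K * n)%N.
  by rewrite mulnC -mulSnr leq_mul2r => ->; rewrite orbT.
move=> [[cell [q [[cK _ _] pE _]]] i b|].
  by rewrite pE in_board.
move=> [cell [q [a [k [[cK qE _] pE kn _ _]]]]] i b.
rewrite pE /slid; case: ifP => _; last exact: in_board.
rewrite /slide; case: ifP => [cq|_].
  have : (n * (cell i b).+1 + n <= K * n)%N.
    by apply: in_board; move: (qE b) (cK i b); lia.
  by rewrite mulnS; lia.
have := in_board _ (cK i b); case: ifP => _; lia.
Qed.

End Tiling.

(** The teams are indexed by the places other than the initial hole. *)
Lemma can_win_blocks K n m : (12 <= K)%N -> (0 < n)%N ->
  can_win (@grid n) m -> can_win (@grid (K * n)) ((K ^ 2 - 1) * m).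
Proof.
move=> K12 n0 /can_win_invariant[W invW].
have K0 : (0 < K)%N by lia.
pose corner : 'I_K * 'I_K := (Ordinal K0, Ordinal K0).
pose team : finType := {c : 'I_K * 'I_K | c != corner}.
pose cell (i : team) := crd (val i).
have corner0 b : crd corner b = 0%N by case: b.
have tl : tiles K cell (fun=> 0%N).
  split=> [i b|b|c cK [b c0]]; [exact: crd_lt | by left |].
  have [x xE] := crd_ex cK.
  have xc : x != corner by apply/eqP => xE'; apply: c0; rewrite -xE xE' corner0.
  by exists (Sub x xc) => a; rewrite /cell SubK xE.
have -> : (K ^ 2 - 1 = #|team|)%N.
  by rewrite card_sig (cardC1 corner) card_prod card_ord mulnn subn1.
rewrite -(card_ord m).
apply: (relay (Inv := fun p r => idle K n p r \/ shifting K n p r) n0 invW).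
- have [r rE] : exists r : 'I_(K * n) * 'I_(K * n), crd r =1 (fun=> (4 * n)%N).
    by apply: crd_ex => b; rewrite ltn_pmul2r //; lia.
  exists (fun i b => (n * cell i b)%N), r; left; exists cell, (fun=> 0%N).
  by split=> //; exists true; rewrite rE muln0 /gap; lia.
- exact: tiling_bound.
- by move=> p r; apply: tiling_step => // b; exact: crd_lt.
Qed.

(** * The exponent *)

Local Open Scope ring_scope.

(** By Bernoulli's inequality, the 143rd power of 1 + 1/143 is at least 2; hence the
858th is at least 64. *)
Lemma expr1000_ge12 (R : realType) : 12 <= (144 / 143) ^+ 1000 :> R.
Proof.
have x1 : 1 <= 144 / 143 :> R by lra.
have two : 2 <= (144 / 143) ^+ 143 :> R.
  have bern k : 1 + k%:R / 143 <= (144 / 143) ^+ k :> R.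
    elim: k => [|k IH]; first by rewrite mul0r addr0 expr0.
    have := ler_wpM2l (le_trans ler01 x1) IH; rewrite exprS -natr1.
    by have : 0 <= k%:R :> R by []; lra.
  by apply: le_trans (bern 143%N); lra.
apply: (@le_trans _ _ ((144 / 143) ^+ (143 * 6))); last by rewrite ler_weXn2l.
rewrite exprM; apply: (@le_trans _ _ (2 ^+ 6)); first by lra.
by rewrite lerXn2r // nnegrE; lra.
Qed.

(** Dividing by 12^2 = 144, the claim says that 144/143 is at least the 1000th root
of 12. *)
Lemma step_exponent (R : realType) : 143 <= 12 `^ (1999%:R / 1000%:R) :> R.
Proof.
set y : R := 12 `^ (1000%:R)^-1.
have y0 : 0 < y by rewrite powR_gt0.
have yX : y ^+ 1000 = 12.
  rewrite -powR_mulrn; last exact: ltW.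
  by rewrite /y -powRrM mulVf ?pnatr_eq0 // powRr1.
have yx : y <= 144 / 143.
  rewrite leNgt; apply/negP => xy.
  have x0 : 0 <= 144 / 143 :> R by lra.
  have : (144 / 143) ^+ 1000 < y ^+ 1000 :> R.
    by rewrite ltrXn2r // nnegrE ltW.
  by rewrite yX; apply/negP; rewrite -leNgt expr1000_ge12.
have : 12 `^ (1999%:R / 1000%:R) * y = 144 :> R.
  rewrite -powRD; last by apply/implyP => _; rewrite pnatr_eq0.
  have -> : 1999%:R / 1000%:R + 1000%:R^-1 = 2%:R :> R by lra.
  by rewrite powR_mulrn //; lra.
have : 0 <= 12 `^ (1999%:R / 1000%:R) :> R by exact: powR_ge0.
by move=> /ler_wpM2l/(_ _ _ yx); lra.
Qed.

Lemma covering_number_leq n m : (0 < n)%N ->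
  can_win (@grid n) m -> (covering_number (@grid n) <= m)%N.
Proof.
move=> n0; apply: (covering_numberP _ _).2.
by rewrite card_prod card_ord muln_gt0 n0.
Qed.

Lemma can_win_power l : can_win (@grid (12 ^ l)) (143 ^ l).
Proof.
elim: l => [|l IH].
  by have := @can_win_card _ (@grid 1); rewrite card_prod card_ord; apply.
by rewrite !expnS; apply: (@can_win_blocks 12) => //; rewrite expn_gt0.
Qed.

Theorem theorem1p2 (R : realType) :
  exists (C : R) (n0 : nat), 0 < C /\
    forall n : nat, (0 < n)%N -> (n0 <= n)%N ->
      (covering_number (@grid n))%:R <= C * n%:R `^ (1999%:R / 1000%:R).
Proof.
exists 143, 0%N; split=> // n n0 _.
have /andP[ln nl] := trunc_log_bounds (isT : (1 < 12)%N) n0.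
set l := trunc_log 12 n in ln nl *.
have fn : (covering_number (@grid n) <= 143 ^ l.+1)%N.
  apply: covering_number_leq => //.
  by apply: can_win_shrink (can_win_power l.+1); rewrite n0 ltnW.
apply: (@le_trans _ _ (143 ^+ l.+1)); first by rewrite -natrX ler_nat.
rewrite exprS ler_pM2l //.
apply: (@le_trans _ _ (((12 ^ l)%N)%:R `^ (1999%:R / 1000%:R))).
  rewrite natrX -powR_mulrn // -powRrM mulrC powRrM powR_mulrn ?powR_ge0 //.
  by rewrite lerXn2r ?nnegrE ?powR_ge0 //; exact: step_exponent.
have a0 : 0 <= 1999%:R / 1000%:R :> R by lra.
apply: (ge0_ler_powR a0); last by rewrite ler_nat.
  by rewrite nnegrE; exact: ler0n.
by rewrite nnegrE; exact: ler0n.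
Qed.
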